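(* Let $m\ge 2$, $n\ge 1$ and let $\mathcal{A}$ be a real $m$-order $n$-dimensional symmetric tensor. Then $\mathcal{A}$ has at least one Pareto $Z$-eigenvalue, namely $$\mu(\mathcal{A})=\min\{\mathcal{A}x^m:\ x\in\mathbb{R}^n,\ x\ge 0,\ \|x\|_2=1\}$$ is a Pareto $Z$-eigenvalue of $\mathcal{A}$. Moreover, $$\mu(\mathcal{A})=\min\{\mu:\ \mu\text{ is a Pareto }Z\text{-eigenvalue of }\mathcal{A}\}.$$
   Context: An $m$-order $n$-dimensional real tensor is an array $\mathcal{A}=(a_{i_1\cdots i_m})$ of real numbers, $i_1,\ldots,i_m\in\{1,\ldots,n\}$; it is symmetric if its entries are invariant under any permutation of the indices. For $x\in\mathbb{R}^n$, $\mathcal{A}x^m=\sum_{i_1,\ldots,i_m=1}^n a_{i_1\cdots i_m}x_{i_1}\cdots x_{i_m}$, and $\mathcal{A}x^{m-1}\in\mathbb{R}^n$ is the vector with components $(\mathcal{A}x^{m-1})_i=\sum_{i_2,\ldots,i_m=1}^n a_{ii_2\cdots i_m}x_{i_2}\cdots x_{i_m}$. $\|x\|_2$ is the Euclidean norm. Vector inequalities are componentwise. A real number $\mu$ is a Pareto $Z$-eigenvalue of $\mathcal{A}$ if there is a non-zero $x\in\mathbb{R}^n$ with $\mathcal{A}x^m=\mu (x^Tx)^{\frac{m}{2}}$, $\mathcal{A}x^{m-1}-\mu (x^Tx)^{\frac{m}{2}-1}x\ge 0$ and $x\ge 0$. *)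

(* Defs.v *)
From HB Require Import structures.
From mathcomp Require Import all_boot all_order all_algebra all_fingroup.
From mathcomp Require Import all_classical all_reals all_analysis.

Set Implicit Arguments.
Unset Strict Implicit.
Unset Printing Implicit Defensive.

Import Order.TTheory GRing.Theory Num.Theory.

Local Open Scope classical_set_scope.
Local Open Scope ring_scope.

Definition tensor (R : Type) (m n : nat) := m.-tuple 'I_n -> R.

Definition symmetric_tensor (R : Type) (m n : nat) (A : tensor R m n) : Prop :=
  forall (s : 'S_m) (t : m.-tuple 'I_n),
    A [tuple tnth t (s k) | k < m] = A t.

(* A x^m *)
Definition tensor_form (R : realType) (m n : nat) (A : tensor R m n)
    (x : 'cV[R]_n) : R :=
  \sum_(t : m.-tuple 'I_n) A t * \prod_(j <- t) x j 0.

(* A x^(m-1), for m >= 1: the sum over (i_2, ..., i_m) is written as a sum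
   over the m-tuples (i, i_2, ..., i_m) with first index i, which avoids a cast
   from m.-1.+1 to m. *)
Definition tensor_apply (R : realType) (m n : nat) (A : tensor R m n)
    (x : 'cV[R]_n) : 'cV[R]_n :=
  \col_i \sum_(t : m.-tuple 'I_n | ohead t == Some i)
            A t * \prod_(j <- behead t) x j 0.

(* x^T x *)
Definition sqnorm (R : realType) (n : nat) (x : 'cV[R]_n) : R :=
  (x^T *m x) 0 0.

(* Not the library norm `|x|, which is the sup norm on matrices. *)
Definition norm2 (R : realType) (n : nat) (x : 'cV[R]_n) : R :=
  Num.sqrt (sqnorm x).

Definition nonneg_vec (R : realType) (n : nat) (x : 'cV[R]_n) : Prop :=
  forall i, 0 <= x i 0.

(* The exponents m/2 and m/2 - 1 are real numbers, hence the power `^. *)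
Definition Pareto_Z_eigenvalue (R : realType) (m n : nat) (A : tensor R m n)
    (mu : R) : Prop :=
  exists x : 'cV[R]_n,
    [/\ x != 0,
        tensor_form A x = mu * sqnorm x `^ (m%:R / 2),
        nonneg_vec (tensor_apply A x
                    - (mu * sqnorm x `^ (m%:R / 2 - 1)) *: x)
      & nonneg_vec x].

(* mu = min S, which includes that the minimum is attained. *)
Definition is_min (R : realType) (S : set R) (mu : R) : Prop :=
  S mu /\ lbound S mu.

(* Main.v *)
(* Let x be a minimiser of A x^m on the compact set of nonnegative unit vectors
   and mu the minimum. By homogeneity A y^m >= mu (y^T y)^(m/2) for every
   nonzero y >= 0, with equality at x; hence s |-> A (x + s e_i)^m -
   mu |x + s e_i|^m has a minimum at 0 over s >= 0, and its derivative there,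
   which by symmetry of A is m ((A x^(m-1))_i - mu x_i), is nonnegative.
   Conversely, a Pareto Z-eigenvalue nu with eigenvector y satisfies
   A y^m = nu (y^T y)^(m/2), so nu >= mu. *)
Require Import Defs.
From HB Require Import structures.
From mathcomp Require Import all_boot all_order all_algebra all_fingroup.
From mathcomp Require Import all_classical all_reals all_analysis.

Set Implicit Arguments.
Unset Strict Implicit.
Unset Printing Implicit Defensive.

Import Order.TTheory GRing.Theory Num.Theory.
Import numFieldNormedType.Exports.

Local Open Scope classical_set_scope.
Local Open Scope ring_scope.

(** Leibniz rule for several factors, by induction: the first factor is split off and the rule for
    two factors applied. *)
Lemma deriv_prod (S : comNzRingType) (k : nat) (F : 'I_k -> {poly S}) :
  (\prod_i F i)^`() = \sum_i (F i)^`() * \prod_(j | j != i) F j.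
Proof.
elim: k F => [|k IHk] F; first by rewrite !big_ord0 -polyC1 derivC.
rewrite !big_ord_recl derivM IHk; congr (_ * _ + _).
  by rewrite [RHS]big_mkcond big_ord_recl /= mul1r.
rewrite mulr_sumr; apply: eq_bigr => i _.
rewrite big_mkcond [in RHS]big_mkcond big_ord_recl/=.
by rewrite mulrCA; congr (_ * (_ * _)).
Qed.

Section Tensor.
Variables (R : realType) (m n : nat) (A : tensor R m n).
Implicit Types x d : 'cV[R]_n.

Lemma tensor_formE x :
  tensor_form A x = \sum_t A t * \prod_(k < m) x (tnth t k) 0.
Proof. by apply: eq_bigr => t _; rewrite big_tuple. Qed.

Lemma tensor_formZ c x : tensor_form A (c *: x) = c ^+ m * tensor_form A x.
Proof.
rewrite !tensor_formE mulr_sumr; apply: eq_bigr => t _.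
rewrite mulrCA; congr (_ * _).
under eq_bigr do rewrite mxE.
by rewrite big_split /= prodr_const card_ord.
Qed.

Lemma sqnormE x : sqnorm x = \sum_i x i 0 ^+ 2.
Proof. by rewrite /sqnorm mxE; apply: eq_bigr => i _; rewrite mxE expr2. Qed.

Lemma sqnorm_ge0 x : 0 <= sqnorm x.
Proof. by rewrite sqnormE sumr_ge0 // => i _; rewrite sqr_ge0. Qed.

Lemma sqnorm_eq0 x : (sqnorm x == 0) = (x == 0).
Proof.
apply/idP/eqP => [|->]; last by rewrite /sqnorm mulmx0 mxE.
rewrite sqnormE psumr_eq0 => [/allP h|i _]; last exact: sqr_ge0.
apply/colP => i; rewrite mxE; apply/eqP.
by have := h i (mem_index_enum i); rewrite sqrf_eq0.
Qed.

Lemma sqnorm_gt0 x : (0 < sqnorm x) = (x != 0).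
Proof. by rewrite lt_def sqnorm_eq0 sqnorm_ge0 andbT. Qed.

Lemma norm2_eq0 x : (norm2 x == 0) = (x == 0).
Proof. by rewrite /norm2 sqrtr_eq0 -sqnorm_eq0 eq_le sqnorm_ge0 andbT. Qed.

Lemma norm2Z c x : 0 <= c -> norm2 (c *: x) = c * norm2 x.
Proof.
move=> c0; rewrite /norm2 [sqnorm (c *: x)]sqnormE.
under eq_bigr do rewrite mxE exprMn.
by rewrite -mulr_sumr -sqnormE sqrtrM ?sqr_ge0 // sqrtr_sqr ger0_norm.
Qed.

(** Trading the real exponent for a natural one makes the degree [m] homogeneity visible, to be
    matched with [tensor_formZ]. *)
Lemma sqnorm_powR_half x : sqnorm x `^ (m%:R / 2) = norm2 x ^+ m.
Proof.
by rewrite mulrC powRrM powR12_sqrt ?sqnorm_ge0 // powR_mulrn ?sqrtr_ge0.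
Qed.

(** Both sides are homogeneous of degree [m], so the bound at [x] follows from the bound at the unit
    vector [x / norm2 x]. *)
Lemma sphere_min_le mu x :
  lbound [set tensor_form A y | y in [set y | nonneg_vec y /\ norm2 y = 1]] mu ->
  nonneg_vec x -> x != 0 ->
  mu * sqnorm x `^ (m%:R / 2) <= tensor_form A x.
Proof.
move=> mulb x0 xn0; have Nn0 : norm2 x != 0 by rewrite norm2_eq0.
have N0 : 0 <= norm2 x by rewrite sqrtr_ge0.
rewrite sqnorm_powR_half.
have -> : tensor_form A x = tensor_form A ((norm2 x)^-1 *: x) * norm2 x ^+ m.
  by rewrite tensor_formZ mulrAC exprVn mulVf ?mul1r // expf_neq0.
apply: ler_wpM2r; first exact: exprn_ge0.
apply: mulb; exists ((norm2 x)^-1 *: x) => //; split; last first.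
  by rewrite norm2Z ?invr_ge0 // mulVf.
by move=> i; rewrite mxE mulr_ge0 ?invr_ge0.
Qed.

(** Row vectors appear because the compactness criterion and the extreme value theorem applied below
    are stated for them. *)
Lemma continuous_tensor_form_tr :
  continuous (fun v : 'rV[R]_n => tensor_form A v^T).
Proof.
apply: continuous_big; first exact: (@add_continuous R).
move=> t _ v.
have prod_cont (r : seq 'I_n) :
    continuous (fun v : 'rV[R]_n => \prod_(j <- r) v^T j 0).
  apply: continuous_big; first exact: (@mul_continuous R).
  move=> j _; rewrite [fun v => _](_ : _ = fun v : 'rV[R]_n => v 0 j).
    exact: coord_continuous.
  by apply/funext => w; rewrite mxE.
exact: (cvgMl_tmp (prod_cont t v)).
Qed.
End Tensor.

(** Heine-Borel: the set is bounded by 1 in the sup norm, as each squared coordinate is at most the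
    sum of squares, and it is closed as an intersection of preimages of closed sets under continuous
    maps. *)
Lemma sphere_compact (R : realType) (n : nat) :
  compact [set v : 'rV[R]_n | nonneg_vec v^T /\ norm2 v^T = 1].
Proof.
have sE v : sqnorm v^T = \sum_i v 0 i ^+ 2 :> R.
  by rewrite sqnormE; apply: eq_bigr => i _; rewrite mxE.
apply: bounded_closed_compact.
  exists 1; split => // M M1 v [_ v1].
  apply: (le_trans _ (ltW M1)).
  rewrite /Num.norm /= mx_normrE; apply: bigmax_le => // -[i j] _ /=.
  rewrite (ord1 i) -(@ler_pXn2r _ 2) ?nnegrE // expr1n.
  have s1 : sqnorm v^T = 1.
    by rewrite -(sqr_sqrtr (sqnorm_ge0 v^T)) -/(norm2 v^T) v1 expr1n.
  rewrite real_normK ?num_real // -s1 sE (bigD1 j) //= lerDl sumr_ge0 // => k _.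
  exact: sqr_ge0.
have -> : [set v : 'rV[R]_n | nonneg_vec v^T /\ norm2 v^T = 1] =
    (\bigcap_i (fun v : 'rV[R]_n => v 0 i) @^-1` [set y | 0 <= y]) `&`
    (fun v : 'rV[R]_n => \sum_i v 0 i ^+ 2) @^-1` [set 1].
  apply/seteqP; split => v /= [h1 h2]; split.
  - by move=> i _ /=; have := h1 i; rewrite mxE.
  - by rewrite -sE -(sqr_sqrtr (sqnorm_ge0 v^T)) -/(norm2 v^T) h2 expr1n.
  - by move=> i; rewrite mxE; exact: h1.
  - by rewrite /norm2 sE h2 sqrtr1.
apply: closedI.
  apply: closed_bigI => i _; apply: preimage_closed; last exact: closed_ge.
  by move=> v _; exact: coord_continuous.
apply: preimage_closed; last exact: closed_eq.
move=> v _; move: v; apply: continuous_big; first exact: (@add_continuous R).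
move=> i _ v; have vi := @coord_continuous R 1 n 0 i v.
exact: (cvgM vi vi).
Qed.

(** The derivative is also the limit of the difference quotients from the right, and these are all
    nonnegative. *)
Lemma is_derive_ge0_at_right_min (R : realType) (h : R -> R) (c d : R) :
  is_derive c 1 h d -> (forall t, c <= t -> h c <= h t) -> 0 <= d.
Proof.
move=> [hd <-] hmin.
apply: (cvgr_to_ge (cvg_dnbhs_at_right hd)).
near=> s; have s0 : 0 < s by near: s; exact: nbhs_right_gt.
rewrite /= mulr_ge0 ?invr_ge0 ?(ltW s0) // subr_ge0; apply: hmin.
by rewrite lerDr /GRing.scale /= mulr1 ltW.
Unshelve. all: by end_near.
Qed.

Section SymmetricTensor.
Variables (R : realType) (m n : nat) (A : tensor R m.+1 n).
Hypothesis hA : symmetric_tensor A.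
Implicit Types x d : 'cV[R]_n.

(* Swapping the indices 0 and [k] reduces to [k = 0], where the sum is split
   according to the first index. *)
Lemma symmetric_tensor_contract x d k :
  \sum_t A t * (d (tnth t k) 0 * \prod_(j | j != k) x (tnth t j) 0) =
  \sum_i d i 0 * tensor_apply A x i 0.
Proof.
pose f (t : m.+1.-tuple 'I_n) := [tuple tnth t (tperm ord0 k j) | j < m.+1].
have fK : involutive f.
  by move=> t; apply: eq_from_tnth => j; rewrite !tnth_mktuple tpermK.
rewrite (reindex_inj (inv_inj fK)).
rewrite (partition_big (fun t => tnth t ord0) xpredT) //=.
apply: eq_bigr => i _; rewrite mxE mulr_sumr.
apply: eq_big => [t|t /eqP <-].
  rewrite (tuple_eta t) /= (tnth_nth (tnth t ord0)) /= /thead.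
  by rewrite inj_eq // => ? ? [].
rewrite hA tnth_mktuple tpermR mulrCA; congr (_ * (_ * _)).
(* The same swap on positions turns the product over [j != k] into one over [j != ord0], that is,
   over the tail of [t]. *)
rewrite (reindex_inj (@perm_inj _ (tperm ord0 k))) /=.
rewrite (eq_bigl (fun j => j != ord0)); last first.
  by move=> j; rewrite (canF_eq (tpermK _ _)) tpermR.
under eq_bigr do rewrite tnth_mktuple tpermK.
rewrite big_mkcond big_ord_recl /= mul1r big_tuple.
apply: eq_bigr => j _; rewrite tnth_behead; congr (x (tnth t _) 0).
by apply: val_inj; rewrite /= inordK // ltnS.
Qed.

(** Along a line the form is a polynomial in [s]. The Leibniz rule at 0 gives one term per index
    position, and by symmetry all [m.+1] positions contribute the same sum. *)
Lemma is_derive_tensor_form x d :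
  is_derive (0 : R) 1 (fun s : R => tensor_form A (x + s *: d))
    (m.+1%:R * \sum_i d i 0 * tensor_apply A x i 0).
Proof.
pose F (t : m.+1.-tuple 'I_n) (k : 'I_m.+1) : {poly R} :=
  (x (tnth t k) 0)%:P + d (tnth t k) 0 *: 'X.
have FE t k s : (F t k).[s] = x (tnth t k) 0 + s * d (tnth t k) 0.
  by rewrite /F !hornerE mulrC.
pose p : {poly R} := \sum_t A t *: \prod_(k < m.+1) F t k.
have -> : (fun s : R => tensor_form A (x + s *: d)) = horner p.
  apply/funext => s; rewrite tensor_formE horner_sum; apply: eq_bigr => t _.
  rewrite hornerZ horner_prod; congr (_ * _); apply: eq_bigr => k _.
  by rewrite FE !mxE.
apply: (is_derive_eq (is_derive_poly p 0)).
rewrite /p raddf_sum horner_sum.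
have dF t : (A t *: \prod_(k < m.+1) F t k)^`().[0] =
    \sum_k A t * (d (tnth t k) 0 * \prod_(j | j != k) x (tnth t j) 0).
  rewrite derivZ hornerZ deriv_prod horner_sum mulr_sumr; apply: eq_bigr => k _.
  rewrite hornerM horner_prod derivD derivC derivZ derivX add0r.
  rewrite alg_polyC hornerC.
  by under eq_bigr do rewrite FE mul0r addr0.
rewrite (eq_bigr _ (fun t _ => dF t)) exchange_big /=.
rewrite (eq_bigr _ (fun k _ => symmetric_tensor_contract x d k)).
by rewrite sumr_const card_ord mulr_natl.
Qed.
End SymmetricTensor.

(** Chain rule: along the line [sqnorm] is a polynomial, and [x != 0] makes its value at 0 positive,
    where the real power is differentiable. *)
Lemma is_derive_sqnorm_powR (R : realType) (n : nat) (x d : 'cV[R]_n) (a : R) :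
  x != 0 ->
  is_derive (0 : R) 1 (fun s : R => sqnorm (x + s *: d) `^ a)
    (a * sqnorm x `^ (a - 1) * (2 * \sum_i d i 0 * x i 0)).
Proof.
move=> xn0.
pose p : {poly R} := \sum_i ((x i 0)%:P + d i 0 *: 'X) ^+ 2.
have pE : (fun s : R => sqnorm (x + s *: d)) = horner p.
  apply/funext => s; rewrite sqnormE horner_sum; apply: eq_bigr => i _.
  by rewrite !hornerE !mxE mulrC.
have p0 : p.[0] = sqnorm x.
  by rewrite -[p.[0]]/(horner p 0) -pE scale0r addr0.
have dp : is_derive (0 : R) 1 (horner p) (2 * \sum_i d i 0 * x i 0).
  apply: (is_derive_eq (is_derive_poly p 0)).
  rewrite /p raddf_sum horner_sum mulr_sumr; apply: eq_bigr => i _.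
  rewrite /= deriv_exp derivD derivC derivZ derivX !hornerE.
  by rewrite /= expr1 -mulrA mulr_natl mulr2n.
have -> : (fun s : R => sqnorm (x + s *: d) `^ a) = ((@powR R)^~ a) \o horner p.
  by rewrite -pE.
have dpow : is_derive p.[0] 1 ((@powR R)^~ a) (a * sqnorm x `^ (a - 1)).
  by rewrite p0; apply: is_derive1_powR; rewrite sqnorm_gt0.
exact: is_derive1_comp.
Qed.

Lemma tensor_form_min_attained (R : realType) (m n : nat) (A : tensor R m n) :
  (0 < n)%N ->
  exists mu, is_min [set tensor_form A x
    | x in [set x : 'cV[R]_n | nonneg_vec x /\ norm2 x = 1]] mu.
Proof.
move=> n0.
pose S := [set v : 'rV[R]_n | nonneg_vec v^T /\ norm2 v^T = 1].
have S0 : S !=set0.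
  (* The first basis vector, available since [0 < n], is a nonnegative unit vector. *)
  exists (delta_mx 0 (Ordinal n0)); split => [i|]; first by rewrite !mxE ler0n.
  rewrite /norm2 sqnormE (bigD1 (Ordinal n0)) //= !mxE !eqxx expr1n.
  rewrite big1 ?addr0 ?sqrtr1 // => i /negPf ni.
  by rewrite !mxE eqxx ni expr0n.
have [v] := EVT_min_rV S0 (@sphere_compact R n)
  (continuous_subspaceT (@continuous_tensor_form_tr R m n A)).
rewrite inE => Sv vmin; exists (tensor_form A v^T); split; first by exists v^T.
by move=> _ [y Sy <-]; rewrite -[y]trmxK; apply: vmin; rewrite inE /S /= trmxK.
Qed.

Theorem theorem4p3 (R : realType) (m n : nat) (hm : (2 <= m)%N)
    (hn : (1 <= n)%N) (A : tensor R m n) (hA : symmetric_tensor A) :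
  exists mu : R,
    [/\ is_min [set tensor_form A x
                 | x in [set x : 'cV[R]_n | nonneg_vec x /\ norm2 x = 1]] mu,
        Pareto_Z_eigenvalue A mu
      & is_min [set nu : R | Pareto_Z_eigenvalue A nu] mu].
Proof.
have [mu mumin] := tensor_form_min_attained A hn.
have [[x [x0 x1] xmu] mulb] := mumin.
have xn0 : x != 0 by rewrite -norm2_eq0 x1 oner_eq0.
have sx : sqnorm x = 1.
  by rewrite -(sqr_sqrtr (sqnorm_ge0 x)) -/(norm2 x) x1 expr1n.
have muP : Pareto_Z_eigenvalue A mu.
  exists x; split => //; first by rewrite sx powR1 mulr1.
  move=> i; rewrite sx powR1 mulr1 !mxE.
  (* The derivative formula is stated for order [m'.+1]; order 0 contradicts [hm]. *)
  case: m hm A hA mumin xmu mulb => // m' hm' A' hA' mumin xmu mulb.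
  pose d : 'cV[R]_n := delta_mx i 0.
  have dE (f : 'I_n -> R) : \sum_j d j 0 * f j = f i.
    rewrite (bigD1 i) //= big1 ?addr0 => [|j /negPf ji].
      by rewrite mxE !eqxx mul1r.
    by rewrite mxE ji mul0r.
  pose h s := tensor_form A' (x + s *: d)
              - mu * sqnorm (x + s *: d) `^ (m'.+1%:R / 2).
  have h0 : h 0 = 0 by rewrite /h scale0r addr0 sx powR1 mulr1 xmu subrr.
  have dh : is_derive (0 : R) 1 h
      (m'.+1%:R * (tensor_apply A' x i 0 - mu * x i 0)).
    apply: is_derive_eq (is_deriveB (is_derive_tensor_form hA' x d)
      (is_deriveZ mu (is_derive_sqnorm_powR d (m'.+1%:R / 2) xn0))) _.
    rewrite !dE sx powR1 mulr1 /GRing.scale /= mulrBr; congr (_ - _).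
    (* The exponent [m'.+1 / 2] meets the factor 2 from differentiating the squares, leaving
       [m'.+1]. *)
    by rewrite mulrA divfK // mulrCA.
  have := is_derive_ge0_at_right_min dh.
  rewrite pmulr_rge0 ?ltr0n // !mxE; apply => s s0; rewrite h0 subr_ge0.
  have x_ge0 j : 0 <= x j 0 by exact: x0.
  have sd_ge0 j : 0 <= (s *: d) j 0 by rewrite !mxE mulr_ge0 ?ler0n.
  apply: (sphere_min_le mulb) => [j|]; first by rewrite mxE addr_ge0.
  (* [x + s *: d] is nonzero: both summands are nonnegative, so if their sum vanished then [x] would
     vanish too. *)
  apply: contra_neq xn0 => /colP y0; apply/colP => j.
  have /eqP : x j 0 + (s *: d) j 0 = 0.
    by have := y0 j; rewrite mxE => ->; rewrite mxE.
  by rewrite paddr_eq0 // => /andP[/eqP -> _]; rewrite mxE.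
exists mu; split => //; split => // nu [y [yn0 ynu _ y0]].
(* With [ynu] this bound compares [mu] and [nu] times the same power of [sqnorm y], which is
   positive and cancels. *)
have := sphere_min_le mulb y0 yn0.
by rewrite ynu ler_pM2r // powR_gt0 // sqnorm_gt0.
Qed.
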